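(* Let $c\in\mathbb{E}^3$, $r>0$, let $x:U\to\mathbb{E}^3\setminus\{c\}$ be a regular patch and let $y=\Phi\circ x$ be its inverse patch, where $\Phi$ is the inversion with center $c$ and radius $r$. Then conjugate vectors in $x$ are invariant under $\Phi_*$ if and only if $\eta=\langle U_x,x-c\rangle=0$ or they are perpendicular. Precisely: let $(u,v)\in U$, $p=x(u,v)$, and let $u_p,v_p\in T_p(x)$ be conjugate vectors of $x$. Then $\Phi_{*p}(u_p)$ and $\Phi_{*p}(v_p)$ are conjugate vectors of $y$ if and only if $\eta(u,v)=0$ or $\langle u_p,v_p\rangle=0$.
   Context: $\mathbb{E}^3$ is Euclidean 3-space. The inversion with center $c$ and radius $r$ is $\Phi:\mathbb{E}^3\setminus\{c\}\to\mathbb{E}^3\setminus\{c\}$, $\Phi(p)=c+\frac{r^2}{\|p-c\|^2}(p-c)$, with tangent map $\Phi_{*p}(v_p)=\frac{r^2 v_p}{\|p-c\|^2}-\frac{2r^2\langle p-c,v_p\rangle}{\|p-c\|^4}(p-c)$. A regular patch is a smooth map $x:U\to\mathbb{E}^3\setminus\{c\}$, $U\subset\mathbb{R}^2$ open, with $x_u\times x_v\neq0$ everywhere; $y=\Phi\circ x$ is then also regular. At a parameter $(u,v)$, $T_p(x)=\mathrm{span}(x_u,x_v)$ with $p=x(u,v)$ (similarly for $y$ at $\Phi(p)$). The unit normals are $U_x=\frac{x_u\times x_v}{\|x_u\times x_v\|}$ and $U_y=\frac{y_u\times y_v}{\|y_u\times y_v\|}$. The shape operator $S$ of $x$ is the linear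 map with $S(x_u)=-\partial_uU_x$, $S(x_v)=-\partial_vU_x$, and the second fundamental form is $II(a,b)=\langle Sa,b\rangle$; $\tilde S$ and $\widetilde{II}$ are defined likewise for $y$ using $U_y$. Tangent vectors $a,b$ of $x$ at a point are conjugate if $II(a,b)=0$; tangent vectors of $y$ are conjugate if $\widetilde{II}$ vanishes on them. The function $\eta$ is $\eta(u,v)=\langle U_x(u,v),x(u,v)-c\rangle$. *)

(* Defs.v *)
From HB Require Import structures.
From mathcomp Require Import all_boot all_order all_algebra.
From mathcomp Require Import ring.
From mathcomp Require Import all_classical all_reals all_analysis.

Set Implicit Arguments.
Unset Strict Implicit.
Unset Printing Implicit Defensive.

Import Order.TTheory GRing.Theory Num.Theory.
Import numFieldNormedType.Exports.

Local Open Scope classical_set_scope.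
Local Open Scope ring_scope.

(** Euclidean 3-space is ['rV[R]_3] and the parameter plane is ['rV[R]_2].
    The library norm [`| |] on row vectors is the sup norm: it is used only
    through the topology it induces.  Lengths are measured by [enorm]. *)

Section Euclidean.
Context {R : realType}.
Implicit Types a b : 'rV[R]_3.

Definition dot a b : R := \sum_i a 0 i * b 0 i.

Definition enorm a : R := Num.sqrt (dot a a).

Definition cross a b : 'rV[R]_3 :=
  \row_k [:: a 0 1 * b 0 2 - a 0 2 * b 0 1;
             a 0 2 * b 0 0 - a 0 0 * b 0 2;
             a 0 0 * b 0 1 - a 0 1 * b 0 0]`_k.

End Euclidean.

Section Inversion.
Context {R : realType}.
Implicit Types (c p v : 'rV[R]_3) (r : R).

(** As [0^-1 = 0], the total function [inversion c r] takes the junk value [c]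
    at [c]; statements about it must exclude that point. *)
Definition inversion c r p : 'rV[R]_3 :=
  c + (r ^+ 2 / enorm (p - c) ^+ 2) *: (p - c).

(** The tangent map of [inversion c r] at [p]; see [is_derive_inversion]. *)
Definition inversion_tangent c r p v : 'rV[R]_3 :=
  (r ^+ 2 / enorm (p - c) ^+ 2) *: v
  - (2 * r ^+ 2 * dot (p - c) v / enorm (p - c) ^+ 4) *: (p - c).

End Inversion.

Section Patch.
Context {R : realType}.
Implicit Types (U : set 'rV[R]_2) (x : 'rV[R]_2 -> 'rV[R]_3) (q : 'rV[R]_2).
Implicit Types (a b c : 'rV[R]_3).

(** [partial 0 x] is x_u and [partial 1 x] is x_v. *)
Definition partial (i : 'I_2) x q : 'rV[R]_3 := 'D_(delta_mx 0 i) x q.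

(** All iterated partial derivatives of order at most [n] exist and are
    continuous at every point of [U].  A patch is represented by a total
    function; for open [U] only its values on [U] matter. *)
Fixpoint Cn_on (n : nat) U x : Prop :=
  (forall q, U q -> {for q, continuous x}) /\
  if n is m.+1 then
    forall i : 'I_2,
      (forall q, U q -> derivable x q (delta_mx 0 i)) /\
      Cn_on m U (partial i x)
  else True.

Definition smooth_on U x : Prop := forall n, Cn_on n U x.

Definition regular_patch U x : Prop :=
  [/\ open U, smooth_on U x &
      forall q, U q -> cross (partial 0 x q) (partial 1 x q) != 0].

Definition frame x q : 2.-tuple 'rV[R]_3 :=
  [tuple partial 0 x q; partial 1 x q].

Definition tangent_plane x q : {vspace 'rV[R]_3} := <<frame x q>>%VS.

Definition unit_normal x q : 'rV[R]_3 :=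
  let n := cross (partial 0 x q) (partial 1 x q) in (enorm n)^-1 *: n.

(** The linear map sending the basis x_u, x_v of the tangent plane to minus the
    partial derivatives of the unit normal; see [shape_partial].  It is
    meaningful only on [tangent_plane x q], at points where x_u and x_v are
    linearly independent. *)
Definition shape x q a : 'rV[R]_3 :=
  \sum_i coord (frame x q) i a *: - partial i (unit_normal x) q.

Definition second_form x q a b : R := dot (shape x q a) b.

Definition conjugate x q a b : Prop :=
  [/\ a \in tangent_plane x q, b \in tangent_plane x q &
      second_form x q a b = 0].

Definition eta c x q : R := dot (unit_normal x q) (x q - c).

End Patch.

Section Facts.
Context {R : realType}.

Lemma enorm_sqr (a : 'rV[R]_3) : enorm a ^+ 2 = dot a a.
Proof.
by rewrite sqr_sqrtr //; apply: sumr_ge0 => i _; rewrite -expr2 sqr_ge0.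
Qed.

Lemma dot_eq0 (a : 'rV[R]_3) : (dot a a == 0) = (a == 0).
Proof.
apply/idP/eqP => [|->]; last by rewrite /dot big1// => i _; rewrite mxE mul0r.
rewrite psumr_eq0; last by move=> i _; rewrite -expr2 sqr_ge0.
move=> /allP h; apply/rowP => i; rewrite mxE.
by apply/eqP; have := h i (mem_index_enum i); rewrite /= mulf_eq0 orbb.
Qed.

Lemma free_frame (x : 'rV[R]_2 -> 'rV[R]_3) q :
  cross (partial 0 x q) (partial 1 x q) != 0 -> free (frame x q).
Proof.
set a := partial 0 x q; set b := partial 1 x q => h.
have crossE s : a = s *: b -> cross a b = 0.
  move=> ->; apply/rowP => -[[|[|[|//]]] ?]; rewrite !mxE/=;
  by apply/eqP; rewrite subr_eq0; apply/eqP; rewrite -!mulrA; congr (_ * _);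
     rewrite mulrC.
rewrite /frame free_cons span_seq1 seq1_free -/a -/b; apply/andP; split.
  by apply/negP => /vlineP [s /crossE h0]; rewrite h0 eqxx in h.
apply: contra h => /eqP b0; apply/eqP/rowP => -[[|[|[|//]]] ?];
  by rewrite b0 !mxE/= !mulr0 subrr.
Qed.

Lemma shape_partial (x : 'rV[R]_2 -> 'rV[R]_3) q (i : 'I_2) :
  cross (partial 0 x q) (partial 1 x q) != 0 ->
  shape x q (partial i x q) = - partial i (unit_normal x) q.
Proof.
move=> /free_frame fr.
have -> : partial i x q = (frame x q)`_i.
  by case: i => -[|[|//]] ?; congr (partial _ x q); apply/val_inj.
rewrite /shape (bigD1 i)//= coord_free// eqxx scale1r big1 ?addr0// => j ji.
by rewrite coord_free// eq_sym (negbTE ji) scale0r.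
Qed.

Lemma is_derive_inversion (c : 'rV[R]_3) (r : R) (p v : 'rV[R]_3) :
  p != c -> is_derive p v (inversion c r) (inversion_tangent c r p v).
Proof.
move=> pc.
have rho0 : dot (p - c) (p - c) != 0 by rewrite dot_eq0 subr_eq0.
have dcoord i : is_derive p v (fun y : 'rV[R]_3 => y 0 i - c 0 i) (v 0 i).
  have did : derivable (fun y : 'rV[R]_3 => y) p v by exact: derivable_id.
  have dpi : is_derive p v (fun y : 'rV[R]_3 => y 0 i) (v 0 i).
    apply: DeriveDef; first exact: (derivable_mxP _ _ _).1.
    have := derive_mx did; rewrite derive_id => /rowP/(_ i).
    by rewrite mxE => <-.
  have dc : is_derive p v (fun=> c 0 i) 0 by exact: is_derive_cst.
  by have := is_deriveB dpi dc; rewrite subr0.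
pose rho (y : 'rV[R]_3) := dot (y - c) (y - c).
have drho : is_derive p v rho (2 * dot (p - c) v).
  have -> : rho = \sum_(i < 3) ((fun y : 'rV[R]_3 => y 0 i - c 0 i) *
                                (fun y : 'rV[R]_3 => y 0 i - c 0 i)).
    apply/funext => y; rewrite fct_sumE /rho /dot.
    by apply: eq_bigr => i _; rewrite !mxE.
  have H := is_derive_sum (fun i => is_deriveM (dcoord i) (dcoord i)).
  apply: (is_derive_eq H); rewrite /dot mulr_sumr; apply: eq_bigr => i _.
  by rewrite !mxE /GRing.scale/=; ring.
have drhoV : is_derive p v (fun y => (rho y)^-1)
    (- (rho p) ^- 2 * (2 * dot (p - c) v)).
  apply: DeriveDef; first exact: derivableV.
  by rewrite deriveV// derive_val.
have dcomp j : is_derive p v (fun y => inversion c r y 0 j)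
    (inversion_tangent c r p v 0 j).
  have dk : is_derive p v (fun=> c 0 j) 0 by exact: is_derive_cst.
  have dr2 : is_derive p v (fun=> r ^+ 2) 0 by exact: is_derive_cst.
  have H := is_deriveD dk (is_deriveM (is_deriveM dr2 drhoV) (dcoord j)).
  have -> : (fun y => inversion c r y 0 j) =
      (fun=> c 0 j) + (fun=> r ^+ 2) * (fun y => (rho y)^-1)
                      * (fun y : 'rV[R]_3 => y 0 j - c 0 j).
    by apply/funext => y; rewrite !mxE enorm_sqr.
  apply: (is_derive_eq H).
  rewrite !mxE enorm_sqr (exprM _ 2 2) enorm_sqr.
  rewrite -[(_ * (fun y => (rho y)^-1)) p]/(r ^+ 2 * (rho p)^-1).
  by rewrite /rho /GRing.scale/=; field.
apply: DeriveDef.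
  by apply/derivable_mxP => i j; rewrite ord1; have [] := dcomp j.
rewrite derive_mx; last first.
  by apply/derivable_mxP => i j; rewrite ord1; have [] := dcomp j.
by apply/matrixP => i j; rewrite ord1 mxE; have [] := dcomp j.
Qed.

End Facts.

(* Main.v *)
(** With w = x - c and k = r^2 / |w|^2, the tangent map of the inversion is k
    times the reflection along w.  Reflections reverse orientation, so the unit
    normal of the inverse patch y is minus the reflection of U_x, that is
    - U_x + (2 eta / |w|^2) w.  Differentiating and using <U_x, x_i> = 0 shows
    that the second fundamental form of y, pulled back by the tangent map, is
    - k (II + (2 eta / |w|^2) <.,.>).  Where II(a, b) = 0 it therefore vanishes
    exactly when eta <a, b> = 0. *)

Require Import Defs.
From mathcomp Require Import all_boot all_order all_algebra.
From mathcomp Require Import ring.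
From mathcomp Require Import all_classical all_reals all_analysis.

Import Order.TTheory GRing.Theory Num.Theory.
Import numFieldNormedType.Exports.

Local Open Scope classical_set_scope.
Local Open Scope ring_scope.

(** * Dot and cross products, reflections, and the tangent map of the inversion *)

Section VectorAlgebra.
Set Implicit Arguments.
Unset Strict Implicit.
Context {R : realType}.
Implicit Types (a b c p u v w : 'rV[R]_3) (k r : R).

Lemma dotE a b : dot a b = a 0 0 * b 0 0 + a 0 1 * b 0 1 + a 0 2 * b 0 2.
Proof.
rewrite /dot !big_ord_recl big_ord0 addr0 addrA.
by congr (_ + a 0 _ * b 0 _ + a 0 _ * b 0 _); apply/val_inj.
Qed.

Lemma row3P a b : a 0 0 = b 0 0 -> a 0 1 = b 0 1 -> a 0 2 = b 0 2 -> a = b.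
Proof.
move=> h0 h1 h2; apply/rowP => -[[|[|[|//]]] ?];
  [move: h0|move: h1|move: h2];
  by congr (a 0 _ = b 0 _); apply/val_inj.
Qed.

Lemma dotC a b : dot a b = dot b a.
Proof. by apply: eq_bigr => i _; rewrite mulrC. Qed.

Lemma dotDl a b v : dot (a + b) v = dot a v + dot b v.
Proof. by rewrite -big_split; apply: eq_bigr => i _; rewrite mxE mulrDl. Qed.

Lemma dotZl k a b : dot (k *: a) b = k * dot a b.
Proof. by rewrite mulr_sumr; apply: eq_bigr => i _; rewrite mxE mulrA. Qed.

Lemma dotNl a b : dot (- a) b = - dot a b.
Proof. by rewrite -scaleN1r dotZl mulN1r. Qed.

Lemma dotDr a b v : dot v (a + b) = dot v a + dot v b.
Proof. by rewrite dotC dotDl !(dotC v). Qed.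

Lemma dotZr k a b : dot b (k *: a) = k * dot b a.
Proof. by rewrite dotC dotZl dotC. Qed.

Lemma dotNr a b : dot a (- b) = - dot a b.
Proof. by rewrite dotC dotNl dotC. Qed.

Lemma dot_suml n (f : 'I_n -> 'rV[R]_3) b :
  dot (\sum_i f i) b = \sum_i dot (f i) b.
Proof.
apply: (big_morph (dot^~ b)) => [u v|]; first exact: dotDl.
by rewrite -(scale0r 0) dotZl mul0r.
Qed.

Lemma dot_crossl a b : dot (cross a b) a = 0.
Proof. by rewrite dotE !mxE /=; ring. Qed.

Lemma dot_crossr a b : dot (cross a b) b = 0.
Proof. by rewrite dotE !mxE /=; ring. Qed.

Lemma crossZ k a b : cross (k *: a) (k *: b) = k ^+ 2 *: cross a b.
Proof. by apply/rowP => -[[|[|[|//]]] ?]; rewrite !mxE /=; ring. Qed.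

Lemma enormZ k a : 0 <= k -> enorm (k *: a) = k * enorm a.
Proof.
move=> k0; rewrite /enorm dotZl dotZr mulrA -expr2 sqrtrM ?sqr_ge0//.
by rewrite sqrtr_sqr ger0_norm.
Qed.

(** Reflection in the plane orthogonal to [w]. *)
Definition reflection w v := v - (2 * dot w v / dot w w) *: w.

Lemma reflectionZ w k v : reflection w (k *: v) = k *: reflection w v.
Proof. by rewrite /reflection dotZr scalerBr scalerA; congr (_ - _ *: _); ring. Qed.

Lemma dot_reflectionr w u v : dot u (reflection w v) = dot (reflection w u) v.
Proof.
by rewrite /reflection dotDr dotDl dotNr dotNl dotZr dotZl (dotC u w); ring.
Qed.

Lemma reflection_self w : w != 0 -> reflection w w = - w.
Proof.
rewrite -dot_eq0 => w0; rewrite /reflection mulfK//.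
by apply/rowP => i; rewrite !mxE; ring.
Qed.

Lemma reflectionK w v : w != 0 -> reflection w (reflection w v) = v.
Proof.
rewrite -dot_eq0 => w0; rewrite /reflection dotDr dotNr dotZr.
by apply/rowP => i; rewrite !mxE; field.
Qed.

(** A self-adjoint involution is an isometry. *)
Lemma dot_reflection w u v : w != 0 -> dot (reflection w u) (reflection w v) = dot u v.
Proof. by move=> w0; rewrite dot_reflectionr reflectionK. Qed.

(* The sign is the determinant of the reflection. *)
Lemma cross_reflection w a b : w != 0 ->
  cross (reflection w a) (reflection w b) = - reflection w (cross a b).
Proof.
rewrite -dot_eq0 dotE => w0.
apply: row3P; rewrite !mxE/= !dotE !mxE /=; by field.
Qed.

Lemma inversion_tangentE c r p v :
  inversion_tangent c r p v = (r ^+ 2 / dot (p - c) (p - c)) *: reflection (p - c) v.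
Proof.
rewrite /inversion_tangent /reflection (exprM _ 2 2) enorm_sqr.
apply/rowP => i; rewrite !mxE.
(* At [p = c] both sides vanish, because [0^-1 = 0]. *)
have [->|w0] := eqVneq (dot (p - c) (p - c)) 0; last by field.
by rewrite expr0n/= invr0; ring.
Qed.

Lemma inversion_tangentD c r p k u v :
  inversion_tangent c r p (k *: u + v) =
  k *: inversion_tangent c r p u + inversion_tangent c r p v.
Proof.
rewrite !inversion_tangentE; move: (p - c) => w.
rewrite /reflection dotDr dotZr.
by apply/rowP => i; rewrite !mxE; ring.
Qed.

Lemma inversion_tangent0 c r p : inversion_tangent c r p 0 = 0.
Proof. by rewrite inversion_tangentE -(scale0r 0) reflectionZ !scale0r scaler0. Qed.

Lemma inversion_tangent_sum c r p n (t : 'I_n -> R) (f : 'I_n -> 'rV[R]_3) :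
  inversion_tangent c r p (\sum_i t i *: f i) =
  \sum_i t i *: inversion_tangent c r p (f i).
Proof.
apply: (big_ind2 (fun u v => inversion_tangent c r p u = v)).
- exact: inversion_tangent0.
- by move=> u _ v _ <- <-; rewrite -[u]scale1r inversion_tangentD !scale1r.
- move=> i _; rewrite -[t i *: f i]addr0 inversion_tangentD.
  by rewrite inversion_tangent0 addr0.
Qed.

End VectorAlgebra.

(** * Directional derivatives of vector-valued maps *)

Section Derivatives.
Set Implicit Arguments.
Unset Strict Implicit.
Context {R : realType} {V : normedModType R}.
Implicit Types (q v : V) (f g w x : V -> 'rV[R]_3) (k : V -> R).
Implicit Types (c : 'rV[R]_3) (r : R).

Lemma is_derive_rowP f q v df :
  is_derive q v f df <-> forall j, is_derive q v (fun y => f y 0 j) (df 0 j).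
Proof.
split=> [[fd <-] j|h].
  apply: DeriveDef; first exact: (derivable_mxP _ _ _).1.
  by rewrite (derive_mx fd) mxE.
have fd : derivable f q v.
  by apply/derivable_mxP => i j; rewrite ord1; have [] := h j.
apply: DeriveDef => //; rewrite derive_mx//.
by apply/matrixP => i j; rewrite ord1 mxE; have [] := h j.
Qed.

Lemma is_derive_dot f g q v df dg :
  is_derive q v f df -> is_derive q v g dg ->
  is_derive q v (fun y => dot (f y) (g y)) (dot df (g q) + dot (f q) dg).
Proof.
move=> /is_derive_rowP fd /is_derive_rowP gd.
have H := is_derive_sum (fun i => is_deriveM (fd i) (gd i)).
rewrite [X in is_derive _ _ X _](_ : _ =
  \sum_(i < 3) ((fun y => f y 0 i) * (fun y => g y 0 i))); last first.
  by apply/funext => y; rewrite fct_sumE.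
apply: (is_derive_eq H); rewrite /dot -big_split; apply: eq_bigr => i _.
by rewrite /GRing.scale/=; ring.
Qed.

Lemma is_derive_scale k f q v dk df :
  is_derive q v k dk -> is_derive q v f df ->
  is_derive q v (fun y => k y *: f y) (dk *: f q + k q *: df).
Proof.
move=> kd /is_derive_rowP fd; apply/is_derive_rowP => j.
rewrite [X in is_derive _ _ X _](_ : _ = k * (fun y => f y 0 j)); last first.
  by apply/funext => y; rewrite mxE.
apply: (is_derive_eq (is_deriveM kd (fd j))).
by rewrite !mxE /GRing.scale/=; ring.
Qed.

Lemma is_derive_inv k q v dk : k q != 0 -> is_derive q v k dk ->
  is_derive q v (fun y => (k y)^-1) (- (k q) ^- 2 * dk).
Proof.
move=> k0 [kd <-]; apply: DeriveDef; first exact: derivableV.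
by rewrite deriveV.
Qed.

Lemma derivable_cross f g q v :
  derivable f q v -> derivable g q v ->
  derivable (fun y => cross (f y) (g y)) q v.
Proof.
move=> /derivable_mxP/(_ 0) fd /derivable_mxP/(_ 0) gd.
apply/derivable_mxP => i j; rewrite ord1.
have H a b : (forall y, cross (f y) (g y) 0 j =
      f y 0 a * g y 0 b - f y 0 b * g y 0 a) ->
    derivable (fun y => cross (f y) (g y) 0 j) q v.
  move=> /funext ->.
  exact: derivableB (derivableM (fd a) (gd b)) (derivableM (fd b) (gd a)).
case: j H => -[|[|[|//]]] ? H; [apply: (H 1 2)|apply: (H 2 0)|apply: (H 0 1)];
  by move=> y; rewrite mxE.
Qed.

Lemma derivable_enorm f q v : f q != 0 ->
  derivable f q v -> derivable (fun y => enorm (f y)) q v.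
Proof.
move=> f0 fd.
have dot_gt0 : 0 < dot (f q) (f q).
  rewrite lt_neqAle eq_sym dot_eq0 f0; apply: sumr_ge0 => i _.
  by rewrite -expr2 sqr_ge0.
have [dd _] := is_derive_dot (derivableP fd) (derivableP fd).
(* Restricted to the line through [q] along [v], derivability becomes differentiability in one
   variable, and the chain rule with the square root applies. *)
move: dd => /derivable1P/derivable1_diffP dd.
apply/derivable1P/derivable1_diffP.
apply: (@differentiable_comp _ _ _ _ _ Num.sqrt) => //.
apply/derivable1_diffP; rewrite scale0r add0r.
by have [] := is_derive1_sqrt dot_gt0.
Qed.

Lemma is_derive_sub_cst f c q v :
  derivable f q v -> is_derive q v (fun y => f y - c) ('D_v f q).
Proof.
move=> /derivableP fd.
have dc : is_derive q v (fun=> c) 0 by exact: is_derive_cst.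
by have := is_deriveB fd dc; rewrite subr0.
Qed.

(** Product rule with the mirror moving too: the terms beyond [reflection (w q) df] come from the
    variation of [w] in the coefficient and in the vector. *)
Lemma is_derive_reflection w f q v dw df :
  w q != 0 -> is_derive q v w dw -> is_derive q v f df ->
  is_derive q v (fun y => reflection (w y) (f y))
    (reflection (w q) df - (2 * dot dw (f q) / dot (w q) (w q)
       - 4 * dot (w q) (f q) * dot (w q) dw / dot (w q) (w q) ^+ 2) *: w q
     - (2 * dot (w q) (f q) / dot (w q) (w q)) *: dw).
Proof.
rewrite -dot_eq0 => w0 wd fd.
have d2 : is_derive q v (fun=> 2 : R) 0 by exact: is_derive_cst.
have dn := is_deriveM d2 (is_derive_dot wd fd).
have di := is_derive_inv w0 (is_derive_dot wd wd).
have H := is_deriveB fd (is_derive_scale (is_deriveM dn di) wd).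
apply: (is_derive_eq H).
rewrite /reflection !fctE /GRing.scale/= (dotC dw (w q)).
by apply/rowP => i; rewrite !mxE; field.
Qed.

(** Directional derivatives alone do not give a chain rule, so the composite is differentiated
    directly by the product and quotient rules. *)
Lemma is_derive_inversion_comp x q v c r :
  x q != c -> derivable x q v ->
  is_derive q v (inversion c r \o x) (inversion_tangent c r (x q) ('D_v x q)).
Proof.
rewrite -subr_eq0 -dot_eq0 => w0 xd.
have wd := is_derive_sub_cst c xd.
have dr : is_derive q v (fun=> r ^+ 2) 0 by exact: is_derive_cst.
have dc : is_derive q v (fun=> c) 0 by exact: is_derive_cst.
have dk := is_deriveM dr (is_derive_inv w0 (is_derive_dot wd wd)).
have H := is_deriveD dc (is_derive_scale dk wd).
rewrite [X in is_derive _ _ X _](_ : _ = (fun=> c) +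
  (fun y => ((fun=> r ^+ 2) * (fun y => (dot (x y - c) (x y - c))^-1)) y
             *: (x y - c))); last first.
  by apply/funext => y; rewrite /= /inversion enorm_sqr.
apply: (is_derive_eq H).
rewrite inversion_tangentE /reflection !fctE /GRing.scale/= (dotC ('D_v x q)).
by apply/rowP => i; rewrite !mxE; field.
Qed.

End Derivatives.

(** * Normals of the inverse patch, and the second fundamental form in coordinates *)

Section SecondForm.
Set Implicit Arguments.
Unset Strict Implicit.
Context {R : realType}.
Implicit Types (x : 'rV[R]_2 -> 'rV[R]_3) (q : 'rV[R]_2) (c : 'rV[R]_3) (r : R).

Lemma partial_inversion c r x q i :
  x q != c -> derivable x q (delta_mx 0 i) ->
  partial i (inversion c r \o x) q = inversion_tangent c r (x q) (partial i x q).
Proof.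
by move=> xc xd; rewrite /partial; have [_ ->] := is_derive_inversion_comp r xc xd.
Qed.

Lemma cross_partial_inversion c r x q :
  x q != c -> (forall i, derivable x q (delta_mx 0 i)) ->
  cross (partial 0 (inversion c r \o x) q) (partial 1 (inversion c r \o x) q) =
  (r ^+ 2 / dot (x q - c) (x q - c)) ^+ 2 *:
    - reflection (x q - c) (cross (partial 0 x q) (partial 1 x q)).
Proof.
move=> xc xd; have w0 : x q - c != 0 by rewrite subr_eq0.
apply: etrans (f_equal2 _ (partial_inversion r xc (xd 0))
                          (partial_inversion r xc (xd 1))) _.
by rewrite !inversion_tangentE crossZ cross_reflection.
Qed.

(** Normalizing cancels the positive factor [k ^+ 2] of the cross product, and the reflection
    preserves length; the reflection and the orientation sign remain. *)
Lemma unit_normal_inversion c r x q :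
  r != 0 -> x q != c -> (forall i, derivable x q (delta_mx 0 i)) ->
  unit_normal (inversion c r \o x) q = - reflection (x q - c) (unit_normal x q).
Proof.
move=> r0 xc xd; rewrite /unit_normal cross_partial_inversion//.
have w0 : x q - c != 0 by rewrite subr_eq0.
set k := _ / _; have k0 : k != 0 by rewrite mulf_neq0 ?expf_neq0 ?invr_eq0 ?dot_eq0.
rewrite enormZ ?sqr_ge0// reflectionZ.
rewrite {1}/enorm dotNl dotNr opprK dot_reflection// -/(enorm _) scalerA.
by rewrite invfM -mulrA mulrCA mulVf ?mulr1 ?expf_neq0// scalerN.
Qed.

(** Apply [is_derive_reflection] to [x - c] and the unit normal; orthogonality of the normal to
    [partial i x q] removes one of the mirror terms. *)
Lemma partial_unit_normal_inversion c r x (U : set 'rV[R]_2) q i :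
  r != 0 -> open U -> U q -> (forall p, U p -> x p != c) ->
  (forall p, U p -> forall j, derivable x p (delta_mx 0 j)) ->
  derivable (unit_normal x) q (delta_mx 0 i) ->
  dot (unit_normal x q) (partial i x q) = 0 ->
  partial i (unit_normal (inversion c r \o x)) q =
  - reflection (x q - c) (partial i (unit_normal x) q)
  - (4 * eta c x q * dot (x q - c) (partial i x q)
       / dot (x q - c) (x q - c) ^+ 2) *: (x q - c)
  + (2 * eta c x q / dot (x q - c) (x q - c)) *: partial i x q.
Proof.
move=> r0 oU Uq xc xd nd n0.
(* Differentiating requires the formula for the normal on a whole neighbourhood of [q], which the
   openness of [U] supplies. *)
have near_eq : \near q, - reflection (x q - c) (unit_normal x q) =
    unit_normal (inversion c r \o x) q.
  near=> p; have Up : U p by near: p; exact: open_nbhs_nbhs.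
  exact: esym (unit_normal_inversion r0 (xc p Up) (xd p Up)).
rewrite [LHS]/partial -(near_eq_derive (delta_mx 0 i) near_eq).
have w0 : x q - c != 0 by rewrite subr_eq0; exact: xc.
have wd := is_derive_sub_cst c (xd q Uq i).
have H := @is_derive_reflection _ _ (fun p => x p - c) _ _ _ _ _ w0 wd (derivableP nd).
have [_ ->] := is_deriveN H.
rewrite /eta (dotC _ (unit_normal x q)) -/(partial i x q) n0.
rewrite (dotC (unit_normal x q)).
cbv beta; move: (partial i x q) (x q - c) => dx w.
by apply/rowP => k; rewrite !mxE; ring.
Unshelve. all: by end_near. Qed.

Lemma derivable_unit_normal x q v :
  (forall i, derivable (partial i x) q v) ->
  cross (partial 0 x q) (partial 1 x q) != 0 -> derivable (unit_normal x) q v.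
Proof.
pose n p := cross (partial 0 x p) (partial 1 x p).
move=> xd n0; have nd : derivable n q v := derivable_cross (xd 0) (xd 1).
have e0 : enorm (n q) != 0.
  by have := n0; rewrite -dot_eq0 -enorm_sqr expf_eq0.
have ed : derivable (fun p => enorm (n p)) q v :=
  derivable_enorm (f := n) n0 nd.
have id := is_derive_inv (k := fun p => enorm (n p)) e0 (derivableP ed).
by have [] := is_derive_scale id (derivableP nd).
Qed.

Lemma dot_unit_normal_partial x q (i : 'I_2) :
  dot (unit_normal x q) (partial i x q) = 0.
Proof.
have [->|->] : i = 0 \/ i = 1.
  by case: i => -[|[|//]] ?; [left|right]; exact/val_inj.
- by rewrite /unit_normal dotZl dot_crossl mulr0.
- by rewrite /unit_normal dotZl dot_crossr mulr0.
Qed.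

Lemma nth_frame x q (i : 'I_2) : (frame x q)`_i = partial i x q.
Proof. by case: i => -[|[|//]] ?; congr (partial _ x q); exact/val_inj. Qed.

(** Tangent vectors are handled through their coefficients, which the tangent map carries unchanged
    from [x] to the inverse patch. *)
Lemma tangent_planeP x q a :
  reflect (exists k : 'I_2 -> R, a = \sum_i k i *: partial i x q)
    (a \in tangent_plane x q).
Proof.
apply: (iffP idP) => [/coord_span aE|[k ->]].
  by exists (fun i => coord (frame x q) i a); rewrite {1}aE;
     apply: eq_bigr => i _; rewrite nth_frame.
apply: memv_suml => i _; apply: memvZ; rewrite -nth_frame; apply: memv_span.
by apply: mem_nth; rewrite size_tuple.
Qed.

(** Regularity makes the frame free, so the coordinates read by [shape] are the given
    coefficients. *)
Lemma second_form_sum x q (k : 'I_2 -> R) b :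
  cross (partial 0 x q) (partial 1 x q) != 0 ->
  second_form x q (\sum_i k i *: partial i x q) b =
  - \sum_i k i * dot (partial i (unit_normal x) q) b.
Proof.
move=> /free_frame fr.
have -> : \sum_i k i *: partial i x q = \sum_(i < 2) k i *: (frame x q)`_i.
  by apply: eq_bigr => i _; rewrite nth_frame.
rewrite /second_form /shape dot_suml -sumrN; apply: eq_bigr => i _.
by rewrite coord_sum_free// dotZl dotNl mulrN.
Qed.

End SecondForm.

(** * Pull-back of the second fundamental form of the inverse patch *)

Section InversePatch.
Set Implicit Arguments.
Unset Strict Implicit.
Context {R : realType} {c : 'rV[R]_3} {r : R} {U : set 'rV[R]_2}.
Context {x : 'rV[R]_2 -> 'rV[R]_3} {q : 'rV[R]_2}.
Hypotheses (r0 : r != 0) (xreg : regular_patch U x).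
Hypotheses (xc : forall p, U p -> x p != c) (Uq : U q).

(** The conformal factor of the inversion at [x q]. *)
Let k := r ^+ 2 / dot (x q - c) (x q - c).

Let w0 : x q - c != 0. Proof. by rewrite subr_eq0; exact: xc. Qed.

Let k0 : k != 0.
Proof. by rewrite mulf_neq0 ?expf_neq0 ?invr_eq0 ?dot_eq0. Qed.

Let xd p : U p -> forall i, derivable x p (delta_mx 0 i).
Proof. by case: xreg => _ sm _ Up i; have [_ /(_ i) [/(_ p Up)]] := sm 1%N. Qed.

Let n0 : cross (partial 0 x q) (partial 1 x q) != 0.
Proof. by case: xreg => _ _; exact. Qed.

Let nd i : derivable (unit_normal x) q (delta_mx 0 i).
Proof.
apply: derivable_unit_normal n0 => j; case: xreg => _ sm _.
(* The normal is built from first partials, so deriving it uses smoothness of order 2. *)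
by have [_ /(_ j) [_ [_ /(_ i) [/(_ q Uq)]]]] := sm 2%N.
Qed.

Let partial_inverse i :
  partial i (inversion c r \o x) q = inversion_tangent c r (x q) (partial i x q).
Proof. by apply: partial_inversion; [exact: xc|exact: xd]. Qed.

(** Scaling by a nonzero factor and reflecting cannot annihilate a vector. This regularity lets
    [second_form_sum] apply to the inverse patch. *)
Let cross_inverse : cross (partial 0 (inversion c r \o x) q)
  (partial 1 (inversion c r \o x) q) != 0.
Proof.
rewrite cross_partial_inversion; [|exact: xc|exact: xd].
rewrite scaler_eq0 expf_eq0 (negPf k0) oppr_eq0; apply: contra n0 => /eqP rn0.
by rewrite -dot_eq0 -(dot_reflection _ _ w0) rn0 dot_eq0.
Qed.

Let inversion_tangent_coord (t : 'I_2 -> R) :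
  inversion_tangent c r (x q) (\sum_i t i *: partial i x q) =
  \sum_i t i *: partial i (inversion c r \o x) q.
Proof.
rewrite inversion_tangent_sum; apply: eq_bigr => i _.
by congr (_ *: _); exact/esym/partial_inverse.
Qed.

Lemma inversion_tangent_plane a : a \in tangent_plane x q ->
  inversion_tangent c r (x q) a \in tangent_plane (inversion c r \o x) q.
Proof.
move=> /tangent_planeP [t ->]; apply/tangent_planeP; exists t.
exact: inversion_tangent_coord.
Qed.

(** With [w = x q - c], the pairing of the two reflected vectors drops its reflections by isometry,
    and [w] pairs with the reflection of [b] to [- dot w b]. The two terms in
    [dot w (partial i x q) * dot w b], with coefficients [4 eta / |w|^4] and [- 4 eta / |w|^4], then
    cancel. *)
Let dot_partial_unit_normal_inverse i b :
  dot (partial i (unit_normal (inversion c r \o x)) q)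
    (inversion_tangent c r (x q) b) =
  - k * (dot (partial i (unit_normal x) q) b
         - 2 * eta c x q / dot (x q - c) (x q - c) * dot (partial i x q) b).
Proof.
have oU : open U by case: xreg.
have pn := partial_unit_normal_inversion r0 oU Uq xc xd (@nd i)
  (dot_unit_normal_partial x q i).
apply: etrans (f_equal2 _ pn (inversion_tangentE _ _ _ _)) _; rewrite -/k.
move: w0 (partial i (unit_normal x) q) (partial i x q) (eta c x q).
move: k (x q - c) => l w wn0 dU dx h.
rewrite dotZr !dotDl !dotNl !dotZl dot_reflection//.
rewrite !(dot_reflectionr w) reflection_self// dotNl /reflection.
rewrite !(dotDl, dotNl, dotZl).
by have := wn0; rewrite -dot_eq0 => ww0; field.
Qed.

(** Sum the preceding formula over the coordinates of [a]. The minus sign in the shape operator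
    turns the difference there into a sum. *)
Lemma second_form_inversion a b : a \in tangent_plane x q ->
  second_form (inversion c r \o x) q
    (inversion_tangent c r (x q) a) (inversion_tangent c r (x q) b) =
  - k * (second_form x q a b
         + 2 * eta c x q / dot (x q - c) (x q - c) * dot a b).
Proof.
move=> /tangent_planeP [t ->]; rewrite inversion_tangent_coord.
rewrite !second_form_sum//.
under eq_bigr => i _ do
  rewrite [X in _ * X](dot_partial_unit_normal_inverse i b).
move: (2 * _ / _) => e.
rewrite dot_suml mulr_sumr -!sumrN -big_split mulr_sumr.
by apply: eq_bigr => i _; rewrite dotZl /=; ring.
Qed.

End InversePatch.

(** * Conjugacy of the image vectors *)

Theorem lemma4p2 (R : realType) (c : 'rV[R]_3) (r : R)
  (U : set 'rV[R]_2) (x : 'rV[R]_2 -> 'rV[R]_3)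
  (hr : 0 < r)
  (hx : regular_patch U x)
  (hc : forall q, U q -> x q != c)
  (q : 'rV[R]_2) (hq : U q)
  (a b : 'rV[R]_3) (hab : conjugate x q a b) :
  conjugate (inversion c r \o x) q
    (inversion_tangent c r (x q) a) (inversion_tangent c r (x q) b)
  <-> (eta c x q = 0 \/ dot a b = 0).
Proof.
have r0 : r != 0 by rewrite gt_eqF.
have d0 : dot (x q - c) (x q - c) != 0 by rewrite dot_eq0 subr_eq0; exact: hc.
have k0 : r ^+ 2 / dot (x q - c) (x q - c) != 0.
  by rewrite mulf_neq0 ?expf_neq0 ?invr_eq0.
have [ta tb ab0] := hab.
have II := second_form_inversion r0 hx hc hq b ta.
(* By conjugacy in [x], only the multiple of [eta c x q * dot a b] survives. *)
rewrite ab0 add0r in II.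
split=> [[_ _]|h].
  rewrite II mulNr => /eqP; rewrite oppr_eq0 mulf_eq0 (negPf k0) /= mulf_eq0.
  case/orP=> [h|/eqP h]; [left|by right].
  (* Among the factors of [2 * eta / |x - c|^2], only [eta] can vanish. *)
  by apply/eqP; move: h; rewrite mulf_eq0 invr_eq0 (negPf d0) orbF mulf_eq0
    pnatr_eq0.
split; [exact: (inversion_tangent_plane hx hc hq ta)|
        exact: (inversion_tangent_plane hx hc hq tb)|].
by rewrite II; case: h => ->; rewrite ?(mulr0, mul0r).
Qed.
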